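(* Let $i\geq 1$ and let $T$ be a semistandard reverse tableau of straight partition shape $\lambda$ such that $\lambda$ has an addable node in column $i$. Then $\mu_i(\rho^{-1}(T))$ is defined and $$\mu_i(\rho^{-1}(T))=\rho_{(1)}^{-1}\big(\mathrm{jdt}_i(T)\big).$$
   Context: Partitions and SSRTs (French convention): a partition $\lambda=(\lambda_1\geq\cdots\geq\lambda_k>0)$ is drawn with $\lambda_r$ left-justified boxes in row $r$, rows numbered from bottom to top and columns from left to right; $(r,c)$ is the box in row $r$, column $c$. An addable node of $\lambda$ is a position outside $\lambda$ whose addition gives a partition; it is determined by its column. A semistandard reverse tableau (SSRT) of shape $\lambda/\mu$ is a filling of the boxes of $\lambda/\mu$ by positive integers, weakly decreasing along rows from left to right and strictly decreasing along columns from bottom to top. $T_{(r,c)}$ denotes the entry in box $(r,c)$. Backward jeu de taquin: for an SSRT $T$ of straight shape $\lambda$ and an addable node $(i_0,j_0)$ of $\lambda$, $\mathrm{jdt}_{j_0}(T)$ is obtained as follows: set $c=(i_0,j_0)$; while $c\neq(1,1)$, writing $c=(p,q)$, let $c'$ be the box among $(p-1,q),(p,q-1)$ (those that exist) holding the smaller entry, with ties going to $(p-1,q)$; slide $T_{c'}$ into $c$ and set $c:=c'$. The result is an SSRT of skew shape $\lambda'/(1)$, where $\lambda'$ is $\lambda$ with the addable node added. Compositions and SSRCTs: a composition $\alpha=(\alpha_1,\ldots,\alpha_l)$ (positive parts) is drawn as its reverse composition diagram: row $r$, counted from top to bottom, has $\alpha_r$ left-justified boxes; $(r,c)$ is the box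 in row $r$ from the top, column $c$. $\widetilde{\alpha}$ is the partition obtained by sorting the parts of $\alpha$. Define $\alpha\lessdot_c\beta$ iff $\beta=(1,\alpha_1,\ldots,\alpha_l)$, or $\beta$ is obtained from $\alpha$ by adding $1$ to a part $\alpha_k$ such that $\alpha_s\neq\alpha_k$ for all $s<k$; let $\leq_c$ be the reflexive transitive closure. For $\beta\leq_c\alpha$ the skew shape $\alpha/\!\!/\beta$ consists of the boxes of $\alpha$ not in $\beta$, where $\beta$ is placed in the bottom-left corner of $\alpha$ (the parts of $\beta$ occupy, left-justified, the last $l(\beta)$ rows of $\alpha$). A semistandard reverse composition tableau (SSRCT) $\tau$ of shape $\alpha/\!\!/\beta$ is a filling of $\alpha/\!\!/\beta$ by positive integers such that (1) rows weakly decrease from left to right, (2) the entries of the first column strictly increase from top to bottom, (3) for rows $r<s$ and a column $c$ with $(s,c+1)\in\alpha/\!\!/\beta$: if $(r,c)\in\beta$ or $\tau(r,c)\geq\tau(s,c+1)$, then either $(r,c+1)\in\beta$ or both $(r,c+1)\in\alpha/\!\!/\beta$ and $\tau(r,c+1)>\tau(s,c+1)$. The map $\rho_\beta$: for an SSRCT $\tau$ of shape $\alpha/\!\!/\beta$, $\rho_\beta(\tau)$ is the SSRT obtained by writing the entries of each column of $\tau$ in decreasing order from bottom to top and bottom-justifying these columns on the inner shape $\widetilde{\beta}$. It is known that $\rho_\beta$ is a bijection from SSRCTs with inner shape $\beta$ to SSRTs with inner shape $\widetilde\beta$; $\rho=\rho_\varnothing$. The operation $\phi_{i+1}$ ($i\geq1$):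 let $\tau$ be an SSRCT of straight shape $\alpha$ having a part equal to $i$, and set $\tau(r,c)=0$ if $(r,c)\notin\alpha$. Let $r_1$ be the largest index with $\alpha_{r_1}=i$; for $j\geq2$ let $r_j$ be the largest $r<r_{j-1}$ with $\tau(r,i)>\tau(r_{j-1},i)\geq\tau(r,i+1)$, stopping at the last such index $r_k$. Then $\phi_{i+1}(\tau)$ is obtained by placing, for $j=k,k-1,\ldots,2$, the original entry $\tau(r_{j-1},i)$ into box $(r_j,i)$, and deleting box $(r_1,i)$ (deleting the row if it becomes empty); the entry $\tau(r_k,i)$ is said to exit. The operation $\mu_i$: for an SSRCT $\tau$ of straight shape, if $i=1$ let $\tau'=\tau$ and $H=\varnothing$; if $i\geq2$ let $\tau'=\phi_2(\phi_3(\cdots\phi_i(\tau)\cdots))$ and let $H$ be the multiset of the $i-1$ entries that exit. If $\tau'$ has shape $(\gamma_1,\ldots,\gamma_s)$, then $\mu_i(\tau)$ is the filling of $(\gamma_1,\ldots,\gamma_s,i)/\!\!/(1)$ whose first $s$ rows agree with $\tau'$ and whose last row has its first box empty and its remaining $i-1$ boxes filled with the elements of $H$ in decreasing order from left to right. *)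

(* Defs.v *)
(* Tableaux are seq (seq nat); all indices 0-based. *)
From Stdlib Require Import Relations.
From mathcomp Require Import all_boot.
Set Implicit Arguments. Unset Strict Implicit. Unset Printing Implicit Defensive.

(* A filling: list of rows, each a list of entries.
   - SSRT (French): row 0 is the bottom row, rows listed bottom to top.
   - SSRCT (reverse composition diagram): row 0 is the top row.
   Paper box (r,c) (1-based) is (r-1,c-1) here.  Boxes of an inner shape
   of a skew filling are stored with entry 0 (entries are positive). *)
Definition tab := seq (seq nat).
Definition get (t : tab) (r c : nat) : nat := nth 0 (nth [::] t r) c.
Definition tab_of (sh : seq nat) (f : nat -> nat -> nat) : tab :=
  [seq mkseq (f r) (nth 0 sh r) | r <- iota 0 (size sh)].
Definition in_shape (sh : seq nat) (r c : nat) : bool := c < nth 0 sh r.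

Definition is_partition (l : seq nat) : bool :=
  sorted geq l && all (fun x => 0 < x) l.

Definition is_SSRT (T : tab) : Prop :=
  is_partition (shape T) /\
  (forall r c, in_shape (shape T) r c -> 0 < get T r c) /\
  (forall r c, in_shape (shape T) r c.+1 -> get T r c.+1 <= get T r c) /\
  (forall r c, in_shape (shape T) r.+1 c -> get T r.+1 c < get T r c).

Definition addable (lam : seq nat) (j : nat) : bool :=
  (j == 0) || (count (fun x => j < x) lam < count (fun x => j.-1 < x) lam).

(* successive source boxes c' of the backward slide starting at (p,q) *)
Fixpoint jpath (f : nat -> nat -> nat) (n p q : nat) : seq (nat * nat) :=
  match n with
  | 0 => [::]
  | n'.+1 =>
    let c' := if p == 0 then (p, q.-1)
              else if q == 0 then (p.-1, q)
              else if f p.-1 q <= f p q.-1 then (p.-1, q) else (p, q.-1) in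
    c' :: jpath f n' c'.1 c'.2
  end.

(* jdt_i(T), i the 1-based column of the addable node; result is a filling
   of shape lam' with 0 in the empty box (1,1). *)
Definition jdt (i : nat) (T : tab) : tab :=
  let lam := shape T in
  let j0 := i.-1 in
  let i0 := count (fun x => j0 < x) lam in
  let f := get T in
  let pts := (i0, j0) :: jpath f (i0 + j0) i0 j0 in
  let g r c :=
    if (r, c) == (0, 0) then 0
    else let k := index (r, c) pts in
         if k < size pts then (let x := nth (0, 0) pts k.+1 in f x.1 x.2)
         else f r c in
  tab_of (incr_nth lam i0) g.

Definition is_composition (a : seq nat) : bool := all (fun x => 0 < x) a.

Definition covc (a b : seq nat) : bool :=
  (b == 1 :: a) ||
  has (fun k => all (fun s => nth 0 a s != nth 0 a k) (iota 0 k) &&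
                (b == set_nth 0 a k (nth 0 a k).+1)) (iota 0 (size a)).

Definition leq_c : relation (seq nat) := clos_refl_trans (seq nat) (fun a b => covc a b).

(* be placed in the bottom-left corner of al *)
Definition in_inner (al be : seq nat) (r c : nat) : bool :=
  (size al - size be <= r) && (c < nth 0 be (r - (size al - size be))).
Definition in_skew (al be : seq nat) (r c : nat) : bool :=
  in_shape al r c && ~~ in_inner al be r c.

Definition is_SSRCT (be : seq nat) (t : tab) : Prop :=
  let al := shape t in
  is_composition al /\ is_composition be /\ leq_c be al /\
   (forall r c, in_inner al be r c -> get t r c = 0) /\
   (forall r c, in_skew al be r c -> 0 < get t r c) /\
   (forall r c, in_skew al be r c -> in_skew al be r c.+1 ->
                get t r c.+1 <= get t r c) /\
   (forall r s, r < s -> in_skew al be r 0 -> in_skew al be s 0 ->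
                get t r 0 < get t s 0) /\
   (forall r s c, r < s -> in_skew al be s c.+1 ->
      (in_inner al be r c || (in_skew al be r c && (get t s c.+1 <= get t r c))) ->
      in_inner al be r c.+1 || (in_skew al be r c.+1 && (get t s c.+1 < get t r c.+1))).

(* rho_be : sort each column decreasingly (bottom to top) and bottom-justify
   it on the inner partition sort(be); inner boxes get entry 0. *)
Definition rho (be : seq nat) (t : tab) : tab :=
  let al := shape t in
  let h c := count (fun x => c < x) be in
  let col c := sort geq [seq get t r c | r <- iota 0 (size t) & in_skew al be r c] in
  let ncols := foldr maxn 0 al in
  let ht c := h c + size (col c) in
  let nrows := foldr maxn 0 [seq ht c | c <- iota 0 ncols] in
  let rowlen r := count (fun c => r < ht c) (iota 0 ncols) in
  tab_of [seq rowlen r | r <- iota 0 nrows]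
         (fun r c => if r < h c then 0 else nth 0 (col c) (r - h c)).

Fixpoint findlast (P : pred nat) (n : nat) : option nat :=
  match n with
  | 0 => None
  | n'.+1 => if P n' then Some n' else findlast P n'
  end.

(* r_2, r_3, ... starting from rp = r_1; cc is the 0-based column i-1;
   get returns 0 outside the shape, as in the paper's convention *)
Fixpoint phichain (t : tab) (cc fuel rp : nat) : seq nat :=
  match fuel with
  | 0 => [::]
  | fuel'.+1 =>
    match findlast (fun r => (get t rp cc < get t r cc) &&
                             (get t r cc.+1 <= get t rp cc)) rp with
    | None => [::]
    | Some r => r :: phichain t cc fuel' r
    end
  end.

(* phi i t = phi_{i+1}(t) together with the exiting entry (None if undefined) *)
Definition phi (i : nat) (t : tab) : option (tab * nat) :=
  if i \in shape t then
    let cc := i.-1 in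
    let r1 := odflt 0 (findlast (fun r => nth 0 (shape t) r == i) (size t)) in
    let ch := phichain t cc (size t) r1 in
    let rs := r1 :: ch in
    let newrow r :=
      let k := index r rs in
      if (0 < k) && (k < size rs)
      then set_nth 0 (nth [::] t r) cc (get t (nth 0 rs k.-1) cc)
      else if r == r1 then take cc (nth [::] t r) else nth [::] t r in
    Some ([seq row <- [seq newrow r | r <- iota 0 (size t)] | 0 < size row],
          get t (last r1 ch) cc)
  else None.

Fixpoint mu_aux (n : nat) (t : tab) : option (tab * seq nat) :=
  match n with
  | 0 => Some (t, [::])
  | n'.+1 =>
    match phi n t with
    | None => None
    | Some (t1, e) =>
      match mu_aux n' t1 with
      | None => None
      | Some (t2, H) => Some (t2, e :: H)
      end
    end
  end.

(* mu_i t, a filling of (gamma, i) // (1) with 0 in the empty box *)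
Definition mu (i : nat) (t : tab) : option tab :=
  match mu_aux i.-1 t with
  | None => None
  | Some (t', H) => Some (rcons t' (0 :: sort geq H))
  end.

(* Main.v *)
(* Everything is read off the numbers [ngt t c x] of entries greater than [x] in
   column [c] (0-based) of [t].  If [rho [::] tau = T] then [x < T r c] iff
   [r < ngt tau c x].  Both sides of the theorem change each column [c] by
   removing an entry [e c] (for [c] left of the addable node) and inserting the
   entry leaving column [c - 1], and in both cases [e c] is the least
   [x >= e c.+1] with [ngt tau c.+1 x = ngt tau c x]:
   - for jeu de taquin, this is the condition for the hole to turn left;
   - for [phi], regard row [r] as the interval from its entry in column [c.+1] to
     its entry in column [c].  The chain of rows covers every value below the
     exiting entry, and no row covers the exiting entry itself.
   The last fact also gives the triple condition for the appended row. *)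
Require Import Defs.
From Stdlib Require Import Relations.
From mathcomp Require Import all_boot zify.
Set Implicit Arguments. Unset Strict Implicit. Unset Printing Implicit Defensive.

(** * Counting entries of columns *)

Lemma eq_ltn_all (a b : nat) : (forall x, (x < a) = (x < b)) -> a = b.
Proof. by move=> e; have := e a; have := e b; lia. Qed.

(** In a weakly decreasing list the entries above [x] form an initial segment. Past the end the
    default 0 is never above [x]. *)
Lemma ltn_nth_sorted_geq (s : seq nat) x r :
  sorted geq s -> (x < nth 0 s r) = (r < count (fun y => x < y) s).
Proof.
elim: s r => [|y s IH] r ss; first by rewrite nth_nil.
have le_y: all (geq y) s by apply: order_path_min ss => a b c /=; lia.
have {}IH := IH _ (path_sorted ss).
have [xy|yx] := ltnP x y; first by case: r => [|r] /=; rewrite xy // IH.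
have c0: count (fun z => x < z) s = 0.
  by apply/eqP; rewrite -leqn0 leqNgt -has_count; apply/hasPn => z /(allP le_y) /=; lia.
by case: r => [|r] /=; rewrite ?IH c0; lia.
Qed.

Lemma ltn_nth_size (s : seq nat) r : 0 \notin s -> (r < size s) = (0 < nth 0 s r).
Proof.
move=> s0; have [rs|rs] := ltnP r (size s); last by rewrite nth_default.
by rewrite lt0n; apply/esym/(memPn s0)/mem_nth.
Qed.

Lemma eq_shape (s1 s2 : seq nat) : 0 \notin s1 -> 0 \notin s2 ->
  (forall r c, (c < nth 0 s1 r) = (c < nth 0 s2 r)) -> s1 = s2.
Proof.
move=> p1 p2 e; apply: (@eq_from_nth _ 0) => [|r _]; apply: eq_ltn_all => x //.
by rewrite !ltn_nth_size.
Qed.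

Lemma ltn_count_iota (P : pred nat) n c :
  (forall c, P c.+1 -> P c) -> (c < count P (iota 0 n)) = (c < n) && P c.
Proof.
move=> dP; elim: n c => [|n IH] c //.
have dP' k : P n -> k <= n -> P k.
  move=> Pn kn; rewrite -(subKn kn); elim: (n - k) => [|j Pj]; first by rewrite subn0.
  have [jn|jn] := ltnP j n; last by rewrite (_ : n - j.+1 = n - j) //; lia.
  by apply: dP; rewrite (_ : (n - j.+1).+1 = n - j) //; lia.
rewrite -[in iota _ _]addn1 iotaD count_cat /= addn0.
have cn := count_size P (iota 0 n); rewrite size_iota in cn.
case Pn: (P n); last first.
  by rewrite addn0 IH ltnS [in RHS]leq_eqVlt; case: eqP => [->|]; rewrite ?ltnn ?Pn.
have cnn: count P (iota 0 n) = n.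
  apply/eqP; rewrite eqn_leq cn /=; case: n {cn} Pn dP' IH => // n Pn dP' IH.
  by rewrite IH ltnSn /= dP'.
by rewrite cnn addn1; case: ltnP => //= cn1; rewrite dP'.
Qed.

Lemma ltn_foldr_maxn r (s : seq nat) :
  (r < foldr maxn 0 s) = has (fun y => r < y) s.
Proof. by elim: s => //= y s <-; rewrite leq_max. Qed.

Lemma shape_tab_of sh f : shape (tab_of sh f) = sh.
Proof.
apply: (@eq_from_nth _ 0); rewrite !size_map size_iota // => r rs.
rewrite (nth_map [::]) ?size_map ?size_iota //.
by rewrite (nth_map 0) ?size_iota // nth_iota // size_mkseq.
Qed.

Lemma nth_tab_of sh f r : nth [::] (tab_of sh f) r = mkseq (f r) (nth 0 sh r).
Proof.
have [rs|rs] := ltnP r (size sh).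
  by rewrite (nth_map 0) ?size_iota // nth_iota.
by rewrite !nth_default ?size_map ?size_iota.
Qed.

Lemma get_tab_of sh f r c :
  get (tab_of sh f) r c = if c < nth 0 sh r then f r c else 0.
Proof.
rewrite /get nth_tab_of; case: ltnP => cs; first by rewrite nth_mkseq.
by rewrite nth_default // size_mkseq.
Qed.

Lemma nth_shape (t : tab) r : nth 0 (shape t) r = size (nth [::] t r).
Proof.
have [rs|rs] := ltnP r (size t); first by rewrite (nth_map [::]).
by rewrite !nth_default // size_map.
Qed.

Lemma get_default (t : tab) r c : ~~ in_shape (shape t) r c -> get t r c = 0.
Proof. by rewrite /in_shape nth_shape -leqNgt => ?; rewrite /get nth_default. Qed.

Definition ngt (t : tab) (c x : nat) : nat := count (fun row => x < nth 0 row c) t.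

Lemma ngt_iota t c x : ngt t c x = count (fun r => x < get t r c) (iota 0 (size t)).
Proof. by rewrite /ngt -{1}(mkseq_nth [::] t) count_map. Qed.

Lemma ngt_leq t c x y : x <= y -> ngt t c y <= ngt t c x.
Proof. by move=> xy; apply: sub_count => row /=; lia. Qed.

(** * The tableau [rho be t] in terms of column counts *)

Section Rho.

Variables (be : seq nat) (t : tab).
Hypothesis inner0 : forall r c, in_inner (shape t) be r c -> get t r c = 0.
Hypothesis skew_gt0 : forall r c, in_skew (shape t) be r c -> 0 < get t r c.

Let h c := count (fun x => c < x) be.

(** An entry above [x] is positive, hence lies in the shape and outside the inner shape; the filter
    loses none of them. *)
Lemma count_rho_col c x :
  count (fun y => x < y)
    (sort geq [seq get t r c | r <- iota 0 (size t) & in_skew (shape t) be r c])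
  = ngt t c x.
Proof.
rewrite (permP (permEl (perm_sort _ _))) ngt_iota count_map count_filter.
apply: eq_count => r /=; case: ltnP => //= gx.
rewrite /in_skew; case: (boolP (in_shape _ _ _)) => [_|/get_default]; last by lia.
by case: (boolP (in_inner _ _ _ _)) => // /inner0; lia.
Qed.

Lemma size_rho_col c :
  size (sort geq [seq get t r c | r <- iota 0 (size t) & in_skew (shape t) be r c])
  = ngt t c 0.
Proof.
rewrite -count_rho_col; apply/esym/eqP; rewrite -all_count.
apply/allP => y; rewrite mem_sort => /mapP[r]; rewrite mem_filter => /andP[/skew_gt0 ? _] ->.
done.
Qed.

Hypothesis inner_cols : forall c, foldr maxn 0 (shape t) <= c -> h c = 0.
Hypothesis ht_anti : forall c, h c.+1 + ngt t c.+1 0 <= h c + ngt t c 0.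

(** Column [c] has height [h c + ngt t c 0]. By [ht_anti] the columns reaching row [r] form an
    initial segment, and [inner_cols] ensures that none lies beyond the last column of [t]. *)
Lemma rho_shape :
  0 \notin shape (rho be t) /\
  forall r c, (c < nth 0 (shape (rho be t)) r) = (r < h c + ngt t c 0).
Proof.
rewrite /rho shape_tab_of; set ncols := foldr _ _ (shape t).
set ht := fun c => _ + _.
have htE c : ht c = h c + ngt t c 0 by rewrite /ht size_rho_col.
have ht0 c : ncols <= c -> ht c = 0.
  move=> nc; rewrite htE inner_cols // add0n; apply/eqP; rewrite -leqn0 leqNgt -has_count.
  apply/hasPn => row rt; rewrite nth_default //; apply: leq_trans nc.
  rewrite leqNgt; apply/negP => lt_row.
  have : ncols < ncols; last by rewrite ltnn.
  by rewrite {2}/ncols ltn_foldr_maxn; apply/hasP; exists (size row); rewrite ?map_f.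
have {ht0} htP r c : (c < count (fun c => r < ht c) (iota 0 ncols)) = (r < ht c).
  rewrite ltn_count_iota => [|{}c]; last by rewrite !htE; have := ht_anti c; lia.
  by case: ltnP => // /ht0 ->.
have nrowsP r : (r < foldr maxn 0 [seq ht c | c <- iota 0 ncols]) = (r < ht 0).
  rewrite ltn_foldr_maxn -[in RHS]htP -has_count has_map.
  exact: eq_has.
have nthE r : nth 0 [seq count (fun c => r < ht c) (iota 0 ncols)
    | r <- iota 0 (foldr maxn 0 [seq ht c | c <- iota 0 ncols])] r
    = count (fun c => r < ht c) (iota 0 ncols).
  have [rn|rn] := ltnP r (foldr maxn 0 [seq ht c | c <- iota 0 ncols]).
    by rewrite (nth_map 0) ?size_iota // nth_iota.
  rewrite nth_default ?size_map ?size_iota //; apply/esym/eqP.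
  by rewrite -leqn0 leqNgt htP -nrowsP -leqNgt.
split=> [|r c]; last by rewrite nthE htP htE.
apply/mapP => -[r]; rewrite mem_iota nrowsP => /andP[_]; rewrite -htP => + e0.
by rewrite -e0.
Qed.

Lemma ltn_get_rho r c x : c < nth 0 (shape (rho be t)) r -> h c <= r ->
  (x < get (rho be t) r c) = (r < h c + ngt t c x).
Proof.
rewrite {1}/rho shape_tab_of => cr hr; rewrite get_tab_of cr ifF; last by rewrite ltnNge hr.
rewrite ltn_nth_sorted_geq; first by rewrite count_rho_col -/(h c); lia.
by apply: sort_sorted => a b /=; lia.
Qed.

Lemma get_rho_inner r c : r < h c -> get (rho be t) r c = 0.
Proof. by move=> rh; rewrite get_tab_of rh if_same. Qed.

End Rho.

(** * The chain of rows of phi *)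

Variant findlast_spec (P : pred nat) (n : nat) : option nat -> Type :=
  | FindlastSome r of r < n & P r & (forall s, r < s < n -> ~~ P s) :
      findlast_spec P n (Some r)
  | FindlastNone of (forall s, s < n -> ~~ P s) : findlast_spec P n None.

Lemma findlastP P n : findlast_spec P n (findlast P n).
Proof.
elim: n => [|n IH] /=; first by constructor.
case Pn: (P n); first by constructor=> // s; lia.
case: IH => [r rn Pr nP|nP]; constructor; rewrite ?ltnS 1?ltnW //.
  move=> s /andP[rs]; rewrite ltnS leq_eqVlt => /orP[/eqP->|sn]; first by rewrite Pn.
  by apply: nP; rewrite rs.
by move=> s; rewrite ltnS leq_eqVlt => /orP[/eqP->|/nP//]; rewrite Pn.
Qed.

(** The column [a] after a chain [rs]: its first row receives [v], each later one the original entry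
    of its predecessor in the chain. *)
Fixpoint shift_col (a : nat -> nat) (v : nat) (rs : seq nat) (r : nat) : nat :=
  if rs is r0 :: rs' then if r == r0 then v else shift_col a (a r0) rs' r else a r.

Lemma shift_colE a v rs r :
  shift_col a v rs r =
  let k := index r rs in
  if k < size rs then if k == 0 then v else a (nth 0 rs k.-1) else a r.
Proof.
elim: rs v => //= r0 rs IH v; rewrite eq_sym; case: eqP => //= _.
by rewrite ltnS IH; case: (index r rs).
Qed.

Lemma count_update (f g : nat -> nat) r0 N y : r0 < N ->
  (forall r, r != r0 -> f r = g r) ->
  count (fun r => y < f r) (iota 0 N) + (y < g r0)
  = count (fun r => y < g r) (iota 0 N) + (y < f r0).
Proof.
move=> + e; elim: N => // N IH; rewrite -[N.+1]addn1 iotaD !count_cat /= !addn0 add0n addn1 ltnS.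
rewrite leq_eqVlt => /orP[/eqP r0N|lt_r0]; last first.
  by have := IH lt_r0; rewrite (e N); lia.
rewrite r0N.
have -> : count (fun r => y < f r) (iota 0 N) = count (fun r => y < g r) (iota 0 N).
  by apply: eq_in_count => r; rewrite mem_iota => rN; rewrite e //; apply/eqP; lia.
lia.
Qed.

Section Chain.

Variables (t : tab) (c : nat).
Let a r := get t r c.
Let b r := get t r c.+1.
Hypothesis ba : forall r, b r <= a r.
Hypothesis triple : forall r s, r < s -> 0 < b s -> b s <= a r -> b s < b r.

(* In the chain, [v] is the entry that replaces [a r]. *)
Definition chain_inv r v :=
  [/\ b r <= v, v < a r & forall s, r < s -> a r < b s \/ a s <= v].

(** A row [s] violating the new invariant has [b s <= a r'] and [a r < a s]. The choice of [r'], or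
    the invariant at [r], gives [a r < b s], and the triple condition then gives [a r < b s < b r'],
    against [b r' <= a r]. *)
Lemma chain_inv_next r v r' : chain_inv r v -> r' < r ->
  a r < a r' -> b r' <= a r -> (forall s, r' < s < r -> ~~ ((a r < a s) && (b s <= a r))) ->
  chain_inv r' (a r).
Proof.
move=> [bv va inv] r'r aa ba' skip; split=> // s r's.
have [//|bs] := ltnP (a r') (b s); first by left.
have [//|as_] := leqP (a s) (a r); first by right.
have := triple r's; have := ba s.
have [sr|rs|sr] := ltngtP s r; last by move: as_; rewrite sr; lia.
  by have := skip s; rewrite r's sr as_ /=; lia.
by case: (inv s rs); lia.
Qed.

(** The outcome of a chain from row [rp]: [a'] is the new column and [x] the exiting entry. The
    third clause records where a changed entry came from, for the triple condition; the last says
    that the column exchanges [x] for [v]. *)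
Definition chain_result rp v (a' : nat -> nat) x :=
  [/\ (forall r, rp < r -> a' r = a r) /\ v < x,
      forall r, b r <= a' r <= a r,
      forall r, a' r = a r \/ chain_inv r (a' r) /\
        (r = rp /\ a' r = v \/ exists s, [/\ r < s, a' r = a s & a' s < a s]),
      (forall r, ~~ (b r <= x < a r)) /\
      (forall y, v <= y < x -> exists r, b r <= y < a r)
    & forall N y, rp < N ->
      count (fun r => y < a' r) (iota 0 N) + (y < x)
      = count (fun r => y < a r) (iota 0 N) + (y < v)].

Lemma chain_result_nil rp v : chain_inv rp v ->
  (forall r, r < rp -> ~~ ((a rp < a r) && (b r <= a rp))) ->
  chain_result rp v (shift_col a v [:: rp]) (a rp).
Proof.
move=> inv none; set a' := shift_col _ _ _; have [bv va invP] := inv.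
have a'E r : r != rp -> a' r = a r by rewrite /a' /= => /negbTE->.
have a'rp : a' rp = v by rewrite /a' /= eqxx.
move: a' a'E a'rp => a' a'E a'rp; split.
- by split=> // r rr; rewrite a'E //; lia.
- move=> r; have [->|nr] := eqVneq r rp; first by rewrite a'rp; lia.
  by rewrite a'E //; have := ba r; lia.
- move=> r; have [->|nr] := eqVneq r rp; last by left; rewrite a'E.
  by right; rewrite a'rp; split=> //; left.
- split=> [r|y ?]; last by exists rp; lia.
  have [rr|rr|->] := ltngtP r rp; [by have := none r rr; lia | | by lia].
  by case: (invP r rr); lia.
- by move=> N y rN; rewrite (@count_update a' a rp) // a'rp.
Qed.

(** Induction from the front of the chain; each step moves to a smaller row index, so [rp <= fuel]
    suffices. *)
Lemma chain_result_phichain fuel rp v : chain_inv rp v -> rp <= fuel ->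
  chain_result rp v (shift_col a v (rp :: phichain t c fuel rp))
    (a (last rp (phichain t c fuel rp))).
Proof.
elim: fuel rp v => [|fuel IH] rp v inv le_fuel.
  move: le_fuel inv; rewrite leqn0 => /eqP-> inv; exact: chain_result_nil.
rewrite [phichain _ _ _ _]/=; case: findlastP => [r' r'r|]; last first.
  move=> none; exact: chain_result_nil.
move=> /andP[aa ba'] skip.
have inv' : chain_inv r' (a rp) by apply: chain_inv_next inv _ _ _ _.
have [] := IH r' (a rp) inv'; first by lia.
set ch := phichain _ _ _ _; set a'' := shift_col _ _ (_ :: ch); set x := a (last _ _).
move=> [out lt_x] ba'' dich [no_x cover] cnt.
have [bv va _] := inv.
have a''rp : a'' rp = a rp by apply: out.
have a'E r : r != rp -> shift_col a v (rp :: r' :: ch) r = a'' r.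
  by move=> /negbTE /= ->.
have a'rp : shift_col a v (rp :: r' :: ch) rp = v by rewrite /= eqxx.
move: (shift_col a v _) a'E a'rp => a' a'E a'rp.
split.
- split; last by apply: ltn_trans va lt_x.
  by move=> r rr; rewrite a'E ?out //; [exact: ltn_trans r'r rr | rewrite neq_ltn rr orbT].
- move=> r; have [->|nr] := eqVneq r rp; first by rewrite a'rp; lia.
  by rewrite a'E.
- move=> r; have [->|nr] := eqVneq r rp; first by right; rewrite a'rp; split=> //; left.
  rewrite a'E //; case: (dich r) => [|[invr H]]; [by left | right; split=> //; right].
  case: H => [[rr' e]|[s [rs e lt_s]]].
    by exists rp; rewrite a'rp rr'; split=> //; rewrite -rr'.
  exists s; split=> //; rewrite a'E //; apply/eqP => srp; move: lt_s; rewrite srp; lia.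
(* Row [rp] covers the values from [v] to below [a rp], the rest of the chain those from [a rp] to
   below [x]. *)
- split=> // y /andP[vy yx]; have [ya|ay] := ltnP y (a rp); first by exists rp; lia.
  by apply: cover; rewrite ay.
- move=> N y rpN; have := cnt N y (ltn_trans r'r rpN); have := @count_update a' a'' rp N y rpN a'E.
  by rewrite a'rp a''rp; lia.
Qed.

End Chain.

Lemma phichain_gt t c fuel rp r :
  r \in phichain t c fuel rp -> get t rp c < get t r c.
Proof.
elim: fuel rp => //= fuel IH rp; case: findlastP => // r' _ /andP[lt _] _.
rewrite inE => /predU1P[-> //|/IH]; exact: ltn_trans.
Qed.

(** * Zero-extended composition tableaux and their counts *)

Lemma filter_nth_mono (T : Type) (x0 : T) (p : pred T) (s : seq T) :
  exists2 f : nat -> nat, {homo f : i j / i < j} &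
    forall i, nth x0 (filter p s) i = nth x0 s (f i).
Proof.
elim: s => [|x s [f f_mono fE]]; first by exists id => // i; rewrite !nth_nil.
rewrite /=; case: ifP => _; last by exists (fun i => (f i).+1) => // i j /f_mono.
exists (fun i => if i is i'.+1 then (f i').+1 else 0) => [|[]//].
by case=> [|i] [|j] // ij; rewrite ltnS f_mono.
Qed.

Lemma sub_count_lt (T : eqType) (P Q : pred T) (s : seq T) x :
  subpred P Q -> x \in s -> Q x -> ~~ P x -> count P s < count Q s.
Proof.
move=> PQ; elim: s => //= y s IH; rewrite inE => /predU1P[<-|xs] Qx nPx.
  by rewrite Qx (negbTE nPx) add0n add1n ltnS sub_count.
by have := IH xs Qx nPx; have := PQ y; case: (P y) => [->//|]; lia.
Qed.

(* With entries extended by 0, the conditions defining an SSRCT of straight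
   shape need no reference to the shape, and survive an empty row. *)
Definition zero_ct (t : tab) : Prop :=
  [/\ forall r c, (c < size (nth [::] t r)) = (0 < get t r c),
      forall r c, get t r c.+1 <= get t r c,
      forall r s, r < s -> 0 < get t r 0 -> 0 < get t s 0 -> get t r 0 < get t s 0
    & forall r s c, r < s -> 0 < get t s c.+1 -> get t s c.+1 <= get t r c ->
        get t s c.+1 < get t r c.+1].

(** Deleting rows is a strictly increasing change of row index, also past the end, where both sides
    are empty rows. *)
Lemma zero_ct_filter p t : zero_ct t -> zero_ct (filter p t).
Proof.
case=> sz row col0 trip; have [f fm fE] := filter_nth_mono [::] p t.
have gE r c : get (filter p t) r c = get t (f r) c by rewrite /get fE.
split=> [r c|r c|r s rs|r s c rs]; rewrite ?fE ?gE //.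
  by apply: col0; apply: fm.
by apply: trip; apply: fm.
Qed.

Lemma ngt_filter t c x : ngt [seq row <- t | 0 < size row] c x = ngt t c x.
Proof.
rewrite /ngt count_filter; apply: eq_count => -[|y row] //=; last by rewrite andbT.
by rewrite nth_nil.
Qed.

(** For [c > 0], equal entries would put [get t s c] weakly below the left neighbour of [get t r c],
    and the triple condition would make them different. *)
Lemma zero_ct_neq t c r s : zero_ct t -> r < s -> 0 < get t s c ->
  get t r c <> get t s c.
Proof.
case=> _ row col0 trip rs s0 e; case: c s0 e => [|c] s0 e.
  by have := col0 r s rs; rewrite e => /(_ s0 s0); lia.
have := trip r s c rs s0; rewrite -e => /(_ (row r c)); lia.
Qed.

(** As rows decrease, every row counted in column [c.+1] is counted in column [c]; the given row is
    counted only in the latter. *)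
Lemma ngt_lt t c x : zero_ct t ->
  (exists r, get t r c.+1 <= x < get t r c) -> ngt t c.+1 x < ngt t c x.
Proof.
case=> _ row _ _ [r /andP[br ar]]; rewrite !ngt_iota.
apply: (sub_count_lt (x := r)) => //; last by rewrite -leqNgt.
  by move=> s /=; have := row s c; lia.
rewrite mem_iota add0n; case: ltnP => // /(nth_default [::]) e.
by move: ar; rewrite /get e nth_nil.
Qed.

Lemma ngt_eq t c x :  zero_ct t ->
  (forall r, ~~ (get t r c.+1 <= x < get t r c)) -> ngt t c.+1 x = ngt t c x.
Proof.
case=> _ row _ _ no; rewrite !ngt_iota; apply: eq_count => r.
by have := no r; have := row r c; lia.
Qed.

Lemma ngt_gap t c x : ngt t c.+1 x < ngt t c x ->
  exists2 r, r < size t & get t r c.+1 <= x < get t r c.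
Proof.
move=> lt; have /hasP[row] : has (fun row => nth 0 row c.+1 <= x < nth 0 row c) t.
  apply: contraLR lt => /hasPn no; rewrite -leqNgt /ngt.
  suff e : {in t, forall row, (x < nth 0 row c) ==> (x < nth 0 row c.+1)}.
    elim: (t) e => //= y s IH e; apply: leq_add.
      by have := e y (mem_head _ _); case: (x < nth 0 y c) => //= ->.
    by apply: IH => z zs; apply: e; rewrite inE zs orbT.
  by move=> row /no /=; lia.
by case/(nthP [::]) => r rt <- gap; exists r.
Qed.

(** * One application of [phi] *)

Section Phi.

Variables (t : tab) (c : nat).
Hypothesis t_ct : zero_ct t.
Let a r := get t r c.
Let b r := get t r c.+1.

(** The deleted box counts as receiving 0. A later row that reaches column [c] also reaches column
    [c.+1]; an entry there of size at most [a r1] would be below [b r1 = 0] by the triple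
    condition. *)
Lemma chain_inv_last r1 : r1 < size t -> size (nth [::] t r1) = c.+1 ->
  (forall s, r1 < s < size t -> size (nth [::] t s) != c.+1) ->
  chain_inv t c r1 0.
Proof.
have [sz row col0 trip] := t_ct.
move=> r1t r1c last_r1; have b0 : b r1 = 0.
  by apply/eqP; rewrite -leqn0 leqNgt -sz r1c ltnn.
split; [by rewrite -/(b r1) b0| by rewrite -sz r1c | move=> s r1s].
have [as0|as_gt0] := posnP (get t s c); [by right; rewrite as0 | left].
rewrite ltnNge; apply/negP => le_b.
have st : s < size t.
  rewrite ltnNge; apply/negP => /(nth_default [::]) e.
  by move: as_gt0; rewrite /get e nth_nil.
have bs_gt0 : 0 < get t s c.+1.
  by rewrite -sz ltn_neqAle eq_sym last_r1 ?r1s // sz.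
by have := trip _ _ _ r1s bs_gt0 le_b; rewrite -/(b r1) b0.
Qed.

(* [t1] is [phi c.+1 t] before the possible deletion of an empty row. *)
Lemma zero_ct_shift t1 r1 a' x :
  (forall r k, get t1 r k = if k == c then a' r else get t r k) ->
  (forall r k, (k < size (nth [::] t1 r)) = (0 < get t1 r k)) ->
  chain_result t c r1 0 a' x -> zero_ct t1.
Proof.
have [sz row col0 trip] := t_ct => t1E t1sz [_ ba'a dich _ _].
(* A positive new entry comes from its own row or a later one, so the old conditions against earlier
   rows apply to it. *)
have a'_src s : 0 < a' s -> exists2 s0, s <= s0 & a' s = a s0.
  case: (dich s) => [->|[_ [[_ ->]//|[s0 [ss0 e _]]]]] _; first by exists s.
  by exists s0 => //; apply: ltnW.
split=> // [r k|r s rs|r s k rs]; rewrite !t1E.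
- have := ba'a r; have := row r k; case: eqP => [->|_]; case: eqP => [<-|_]; lia.
- case: eqP => [c0 r_gt0 s_gt0|_]; last exact: col0.
  have [s0 ss0 e] := a'_src _ s_gt0.
  have := ba'a r; have := ba'a s; rewrite e => as_ ar.
  have col u v : u < v -> 0 < a u -> 0 < a v -> a u < a v by rewrite /a -c0; apply: col0.
  have ar' : a' r <= a r by case/andP: ar.
  by apply: leq_ltn_trans ar' (col _ _ (leq_trans rs ss0) (leq_trans r_gt0 ar') _); rewrite -e.
have [kc|nkc] := eqVneq k c.
  rewrite -kc (gtn_eqF (ltnSn k)) => s_gt0 le; apply: trip => //.
  by have := ba'a r; rewrite kc in le *; lia.
case: eqP => [kc|_]; last exact: trip.
move=> s_gt0 le; have [s0 ss0 e] := a'_src _ s_gt0.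
have lt_a : a s0 < a r.
  by rewrite /a -kc; apply: trip; rewrite ?kc -/(a s0) -?e //; apply: leq_trans rs ss0.
have := ba'a s; case: (dich r) => [->|[[_ _ inv] alt]]; first by rewrite e.
move=> /andP[bs le_as].
have {inv} as_le : a s <= a' r.
  case: (inv s rs) => // lt_b; have s0r : a' s < a r by rewrite e.
  by have := ltn_trans lt_b (leq_ltn_trans bs s0r); rewrite ltnn.
(* In case of equality row [s] is unchanged, while [a' r] came from a changed row [s1] with the same
   old entry. Column entries are distinct, so [s = s1], a contradiction. *)
rewrite ltn_neqAle (leq_trans le_as as_le) andbT; apply/eqP => eq_sr.
have eq_as : a s = a' s by apply/eqP; rewrite eqn_leq le_as eq_sr as_le.
case: alt => [[_ a'r0]|[s1 [rs1 a'r lt1]]]; first by move: s_gt0; rewrite eq_sr a'r0.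
have s_s1 : a s = a s1 by rewrite eq_as eq_sr.
have s_gt0' : 0 < a s by rewrite eq_as.
have [lt|lt|eq_s] := ltngtP s s1.
- by apply: (zero_ct_neq t_ct lt _ s_s1); rewrite -/(a s1) -s_s1.
- exact: (zero_ct_neq t_ct lt s_gt0' (esym s_s1)).
- by move: lt1; rewrite -eq_s -eq_as ltnn.
Qed.

End Phi.

Lemma get_gt0_size t r c : 0 < get t r c -> r < size t.
Proof.
move=> r_gt0; rewrite ltnNge; apply/negP => /(nth_default [::]) e.
by move: r_gt0; rewrite /get e nth_nil.
Qed.

(** The gap at 0 provides a row of length [c.+1]. The last two clauses translate the covering clause
    of [chain_result] with [v = 0]. *)
Lemma zero_ct_phi c t : zero_ct t -> ngt t c.+1 0 < ngt t c 0 ->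
  exists t' e,
  [/\ phi c.+1 t = Some (t', e) /\ 0 < e, zero_ct t' /\ [::] \notin t',
      forall k x, ngt t' k x + (k == c) * (x < e) = ngt t k x,
      ngt t c.+1 e = ngt t c e
    & forall x, x < e -> ngt t c.+1 x < ngt t c x].
Proof.
move=> t_ct gap0; have [sz row col0 trip] := t_ct.
have [r2 r2t r2gap] := ngt_gap gap0.
have sz_r r : get t r c.+1 <= 0 < get t r c -> size (nth [::] t r) = c.+1.
  by rewrite -sz leqNgt -sz -leqNgt => lt; apply/eqP; rewrite eqn_leq.
have c_in : c.+1 \in shape t by apply/mapP; exists (nth [::] t r2); rewrite ?mem_nth ?sz_r.
rewrite /phi c_in [c.+1.-1]/=; case: findlastP => [r1 r1t|none]; last first.
  by have := none _ r2t; rewrite nth_shape sz_r ?eqxx.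
rewrite nth_shape => /eqP r1c last_r1; rewrite [odflt _ _]/=.
have inv1 : chain_inv t c r1 0.
  by apply: chain_inv_last => // s /last_r1; rewrite nth_shape.
have row_c r : get t r c.+1 <= get t r c by apply: row.
have trip_c r s : r < s -> 0 < get t s c.+1 -> get t s c.+1 <= get t r c ->
  get t s c.+1 < get t r c.+1 by apply: trip.
have res := chain_result_phichain row_c trip_c inv1 (ltnW r1t).
have ch_gt r : r \in r1 :: phichain t c (size t) r1 -> 0 < get t r c.
  have r1_gt0 : 0 < get t r1 c by rewrite -sz r1c.
  by rewrite inE => /predU1P[->//|/phichain_gt]; apply: ltn_trans.
move: (phichain t c (size t) r1) res ch_gt => ch res ch_gt.
set a' := shift_col _ _ _ in res; set e := get t _ c in res *.
set rs := r1 :: ch in ch_gt *; set t1 := [seq (if _ then _ else _) | r <- _].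
(* Later rows of the chain get one new entry, row [r1] is cut before column [c], which amounts to
   the entry 0, and all other rows stay. *)
have t1E r k : get t1 r k = (if k == c then a' r else get t r k) /\
    (k < size (nth [::] t1 r)) = (0 < get t1 r k).
  pose i := index r rs.
  have a'E : a' r = if i < size rs then if i == 0 then 0 else get t (nth 0 rs i.-1) c
                    else get t r c by rewrite /a' shift_colE.
  have [rt|tr] := ltnP r (size t); last first.
    have t0 j : get t r j = 0 by rewrite /get (nth_default [::] tr) nth_nil.
    have t10 : nth [::] t1 r = [::] by rewrite nth_default // size_map size_iota.
    rewrite [get t1 r k]/get t10 nth_nil t0.
    case: res => _ /(_ r)/andP[_]; rewrite t0 leqn0 => /eqP-> _ _ _.
    by rewrite if_same.
  rewrite /get (nth_map 0) ?size_iota // nth_iota // add0n -/(get t r k).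
  have rk : (k < size (nth [::] t r)) = (0 < get t r k) by apply: sz.
  rewrite -/i.
  case: ifP => [/andP[i_gt0 i_lt]|i_out].
    rewrite i_lt gtn_eqF // in a'E.
    have a'_gt0 : 0 < a' r by rewrite a'E ch_gt // mem_nth // (leq_ltn_trans (leq_pred i) i_lt).
    have rc : c < size (nth [::] t r) by rewrite sz ch_gt // -index_mem.
    rewrite nth_set_nth size_set_nth (maxn_idPr rc) /= -a'E -/(get t r k).
    by case: eqP => [->|_]; split=> //; rewrite rc a'_gt0.
  case: eqP => [r_r1|r_r1].
    have i0 : i = 0 by rewrite /i r_r1 /= eqxx.
    rewrite a'E i0 /= size_take r_r1 r1c ltnSn.
    have [kc|kc|->] := ltngtP k c.
    - by rewrite nth_take // -r_r1; split=> //; rewrite -rk r_r1 r1c; lia.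
    - rewrite nth_default ?size_take ?r1c ?ltnSn //; last by lia.
      by split=> //; apply/esym/eqP; rewrite -leqn0 leqNgt -sz r1c; lia.
    - by rewrite nth_default ?size_take ?r1c ?ltnSn.
  have i_gt0 : 0 < i by rewrite /i /=; case: eqP => // /esym.
  rewrite i_gt0 /= in i_out; rewrite a'E i_out -/(get t r k) rk.
  by split=> //; case: eqP => [->|].
have t1_ct : zero_ct t1.
  by apply: (zero_ct_shift t_ct _ _ res) => r k; case: (t1E r k).
have [[_ e_gt0] _ _ [no_e cover] cnt] := res.
exists [seq row <- t1 | 0 < size row], e; split=> //.
- by split; [apply: zero_ct_filter | rewrite mem_filter].
- move=> k x; rewrite ngt_filter !ngt_iota size_map size_iota.
  have [->|nkc] := eqVneq k c.
    have := cnt (size t) x r1t; rewrite mul1n addn0 => <-; congr (_ + _).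
    by apply: eq_count => r; case: (t1E r c) => ->; rewrite eqxx.
  rewrite mul0n addn0; apply: eq_count => r; case: (t1E r k) => -> _.
  by rewrite (negbTE nkc).
- exact: ngt_eq.
- by move=> x xe; apply: ngt_lt => //; apply: cover.
Qed.

(** * Jeu de taquin *)

Definition slide (f : nat -> nat -> nat) (pts : seq (nat * nat)) r c :=
  let k := index (r, c) pts in
  if k < size pts then (let x := nth (0, 0) pts k.+1 in f x.1 x.2) else f r c.

Lemma slide_cons f p p' pts r c :
  slide f (p :: p' :: pts) r c =
  if (r, c) == p then f p'.1 p'.2 else slide f (p' :: pts) r c.
Proof. by rewrite /slide [index _ (p :: _)]/= eq_sym; case: eqP. Qed.

Section Jdt.

Variables (f K : nat -> nat -> nat).
Hypothesis fK : forall r c x, (x < f r c) = (r < K c x).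
Hypothesis K_anti : forall c x, K c.+1 x <= K c x.

Lemma jpathS n p q : jpath f n.+1 p q =
  let c' := if (p == 0) || (0 < q) && (f p q.-1 < f p.-1 q) then (p, q.-1) else (p.-1, q) in
  c' :: jpath f n c'.1 c'.2.
Proof.
rewrite /=; case: (p =P 0) => //= _; case: (q =P 0) => [->//|/eqP]; rewrite -lt0n => -> /=.
by rewrite ltnNge; case: leqP.
Qed.

Lemma slide_right n p q r c : q < c -> slide f ((p, q) :: jpath f n p q) r c = f r c.
Proof.
elim: n p q => [|n IH] p q qc.
  rewrite /slide /= ; case: eqP => // -[_]; lia.
rewrite jpathS; case: ifP => _; rewrite slide_cons xpair_eqE (gtn_eqF qc) andbF IH //=; lia.
Qed.

(* [e c] is the entry leaving column [c]; [e q] is the one originally at the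
   hole. *)
Definition exits q (e : nat -> nat) := forall c, c < q ->
  [/\ e c.+1 <= e c, K c.+1 (e c) = K c (e c)
    & forall x, e c.+1 <= x < e c -> K c.+1 x < K c x].

(** At [x = f p q] the test for turning left makes both counts equal to [p]. For smaller
    [x >= e q.+1], row [p] is counted in column [q] but not in column [q.+1]. *)
Lemma exits_left p q e : exits q.+1 e -> e q.+1 = f p q.+1 ->
  (p == 0) || (f p q < f p.-1 q.+1) -> e q = f p q.
Proof.
move=> ex ep left; have [le_e eq_e lt_e] := ex q (ltnSn _).
apply/eqP; rewrite eqn_leq; apply/andP; split; rewrite leqNgt; apply/negP => lt.
  have := lt_e (f p q); rewrite lt ep.
  have := fK p q (f p q); have := fK p q.+1 (f p q); have := K_anti q (f p q).
  have := fK p.-1 q.+1 (f p q); case/orP: left => [/eqP p0|->]; lia.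
have := fK p q (e q); have := fK p q.+1 (e q); lia.
Qed.

(** Raising [e q] to [f p q] only shortens a range, provided [f p q <= e q.-1]. Otherwise
    [f p.+1 q.-1] exceeds [e q.-1], and by equality of the counts so does [f p.+1 q = e q]. *)
Lemma exits_down p q e : exits q e -> e q = f p.+1 q ->
  (q == 0) || (f p q <= f p.+1 q.-1) ->
  exits q (fun c => if c == q then f p q else e c).
Proof.
move=> ex ep down c cq; rewrite (ltn_eqF cq); have [le_e eq_e lt_e] := ex c cq.
case: eqP => [cq'|_]; last by [].
rewrite -cq' /= in ep down *.
suff le : f p c.+1 <= e c by split=> // x xe; apply: lt_e; rewrite ep;
  have := fK p.+1 c.+1 x; have := fK p c.+1 x; lia.
rewrite leqNgt; apply/negP => lt.
have := fK p c.+1 (e c); have := fK p.+1 c (e c); have := fK p.+1 c.+1 (e c).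
lia.
Qed.

(** Column [c] loses [e c] and gains [e c.-1]; column 0 gains the empty corner, counted as larger
    than every [x]. Induction along the path of the hole. *)
Lemma ltn_slide p q e : exits q e -> e q = f p q ->
  forall r c x, c <= q -> (r, c) != (0, 0) ->
  (x < slide f ((p, q) :: jpath f (p + q) p q) r c)
  = (r + (x < e c) < K c x + ((c == 0) || (x < e c.-1))).
Proof.
move En : (p + q) => n; elim: n p q En e => [|n IH] p q pq e ex ep r c x cq rc.
  have [p0 q0 c0] : [/\ p = 0, q = 0 & c = 0] by split; lia.
  rewrite p0 q0 c0 in rc ep *; rewrite /slide /= eq_sym (negbTE rc) ltnn.
  rewrite ep !fK; move: rc; rewrite xpair_eqE; lia.
rewrite jpathS; case: ifP => [left|down].
- case: q pq ex ep cq left => [|q] pq ex ep cq left; first by lia.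
  rewrite slide_cons /= in left *; have eq_q := exits_left ex ep left.
  have [cq1|cq1] := leqP c q.
    rewrite xpair_eqE (ltn_eqF (_ : c < q.+1)) // andbF.
    by apply: IH => //; [lia | move=> k kq; apply: ex; lia].
  have {cq cq1} -> : c = q.+1 by lia.
  rewrite slide_right // xpair_eqE eqxx andbT /= ep eq_q.
  have := fK p q.+1 x; have := fK p q x; have := fK r q.+1 x.
  have := fK p.-1 q.+1 x; have := K_anti q x.
  by case: eqP => [->|rp]; lia.
- have p_gt0 : 0 < p by lia.
  case: p pq ep p_gt0 down => // p pq ep _ /= down.
  rewrite slide_cons.
  have {}down : (q == 0) || (f p q <= f p.+1 q.-1) by lia.
  have ex' := exits_down ex ep down.
  have {}IH := IH p q ltac:(lia) _ ex' ltac:(by rewrite /= eqxx) r c x cq rc.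
  rewrite [_.1]/= [_.2]/=; have fKp := fK p q x; have fKp1 := fK p.+1 q x.
  have le_f : (q == 0) || (f p q <= e q.-1).
    case: (q) ex' => // q' /(_ q' (ltnSn _))[]; rewrite eqxx (ltn_eqF (ltnSn q')).
    by move=> ->.
  have [[-> ->] | neq] := eqVneq (r, c) (p.+1, q).
    by rewrite ep; case: (q) le_f fKp fKp1 => [|q'] /=;
       rewrite ?(ltn_eqF (ltnSn _)); lia.
  rewrite IH {IH}; move: neq; rewrite xpair_eqE; case: (eqVneq c q) => [-> rp|cq' _]; last first.
    by rewrite (_ : c.-1 == q = false) //; lia.
  (* The two exit values differ only for [f p.+1 q <= x < f p q]. There the count is [p.+1], so only
     the excluded row [p.+1] would be affected. *)
  rewrite ep; case: (q) le_f fKp fKp1 => [|q'] /=; rewrite ?(ltn_eqF (ltnSn _)); lia.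
Qed.


End Jdt.

(** * The tableau mu *)

Lemma ngt_anti t c x : zero_ct t -> ngt t c.+1 x <= ngt t c x.
Proof.
by case=> _ row _ _; rewrite !ngt_iota; apply: sub_count => r /=; have := row r c; lia.
Qed.

(** Columns are treated from right to left, so [rev H] is indexed by column. When column [c] is
    treated, column [c.+1] is already that of [t'] and column [c] is still that of [t]. *)
Lemma zero_ct_mu_aux n t : zero_ct t -> [::] \notin t ->
  (n == 0) || (ngt t n 0 < ngt t n.-1 0) ->
  exists t' H,
  [/\ mu_aux n t = Some (t', H) /\ size H = n, zero_ct t' /\ [::] \notin t',
      forall c x, ngt t' c x + (x < nth 0 (rev H) c) = ngt t c x,
      forall c, c < n -> let e := nth 0 (rev H) c in
        0 < e /\ ngt t' c.+1 e = ngt t c e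
    & forall c x, x < nth 0 (rev H) c -> ngt t' c.+1 x < ngt t c x].
Proof.
elim: n t => [|n IH] t t_ct t_ne gap.
  by exists t, [::]; split=> //= c x; rewrite nth_nil // addn0.
have [t1 [e [[phiE e_gt0] [t1_ct t1_ne] t1E eq_e lt_e]]] := zero_ct_phi t_ct gap.
have t1E' k x : k != n -> ngt t1 k x = ngt t k x.
  by move=> /negbTE kn; rewrite -t1E kn addn0.
(* Column [n] has just lost an entry and column [n.-1] none, so the next application of [phi] is
   defined. *)
have gap1 : (n == 0) || (ngt t1 n 0 < ngt t1 n.-1 0).
  case: n gap {IH phiE eq_e lt_e} t1E t1E' => // n _ t1E t1E' /=.
  rewrite (t1E' n) ?ltn_eqF //; have := ngt_anti n 0 t_ct; have := t1E n.+1 0.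
  by rewrite eqxx e_gt0; lia.
have [t' [H [[muE szH] [t'_ct t'_ne] t'E eq_H lt_H]]] := IH t1 t1_ct t1_ne gap1.
have revH c : nth 0 (rev (e :: H)) c = if c == n then e else nth 0 (rev H) c.
  rewrite rev_cons nth_rcons size_rev szH; case: ltngtP => // nc.
  by rewrite nth_default // size_rev szH ltnW.
have revH_ge c : n <= c -> nth 0 (rev H) c = 0.
  by move=> nc; rewrite nth_default // size_rev szH.
have t'n x : ngt t' n.+1 x = ngt t n.+1 x.
  by rewrite -(t1E' n.+1) ?gtn_eqF // -t'E revH_ge // addn0.
exists t', (e :: H); rewrite /= phiE muE szH; split=> // [c x|c cn|c x].
- rewrite revH -t1E -t'E; case: eqP => [->|_]; last by rewrite addn0.
  by rewrite revH_ge //; lia.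
- rewrite revH; case: eqP => [->|cn']; first by rewrite t'n.
  have [|e_c ->] := eq_H c; first by lia.
  by rewrite t1E' //; apply/eqP.
- rewrite revH; case: eqP => [-> xe|/eqP cn xe]; first by rewrite t'n lt_e.
  by rewrite -(t1E' c) // lt_H.
Qed.

Lemma SSRCT_zero_ct t : is_SSRCT [::] t -> zero_ct t /\ [::] \notin t.
Proof.
case=> comp [_ [_ [_ [pos [row [col0 trip]]]]]].
have innerF r c : in_inner (shape t) [::] r c = false by rewrite /in_inner nth_nil andbF.
have skewE r c : in_skew (shape t) [::] r c = (c < size (nth [::] t r)).
  by rewrite /in_skew innerF andbT /in_shape nth_shape.
have sz r c : (c < size (nth [::] t r)) = (0 < get t r c).
  have [cs|cs] := ltnP c (size (nth [::] t r)); first by rewrite pos ?skewE.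
  by rewrite /get nth_default.
have {}skewE r c : in_skew (shape t) [::] r c = (0 < get t r c) by rewrite skewE sz.
split; last first.
  by apply/negP => /(map_f size) e0; have := allP comp _ e0.
split=> // [r c|r s rs r0 s0|r s c rs s_gt0 le].
- have [->//|gt0] := posnP (get t r c.+1); apply: row; rewrite skewE //.
  by move: gt0; rewrite -!sz; apply: ltnW.
- by apply: col0; rewrite ?skewE.
- have := trip r s c rs; rewrite !innerF !skewE s_gt0 le andbT /= => /(_ isT).
  by move=> /(_ (leq_trans s_gt0 le)) /andP[].
Qed.

Lemma leq_c_cons a be al : leq_c be al -> 0 < a -> leq_c be (a :: al).
Proof.
move=> le; case: a => // a _; elim: a => [|a IH].
  by apply: rt_trans le (rt_step _ _ _ _ _); rewrite /covc eqxx.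
apply: rt_trans IH (rt_step _ _ _ _ _); apply/orP; right; apply/hasP; exists 0 => //=.
Qed.

(** The last part is grown first, while it is alone; the others are then put on top one by one. *)
Lemma leq_c_rcons al n : is_composition al -> leq_c [:: 1] (rcons al n.+1).
Proof.
elim: al => [_|a al IH /= /andP[a0 alP]]; last by apply: leq_c_cons; first exact: IH.
elim: n => [|n IH]; first exact: rt_refl.
by apply: rt_trans IH (rt_step _ _ _ _ _); apply/orP; right; rewrite /= eqxx.
Qed.

Lemma eq_tab (t1 t2 : tab) : shape t1 = shape t2 ->
  (forall r c, c < nth 0 (shape t1) r -> get t1 r c = get t2 r c) -> t1 = t2.
Proof.
move=> sh e; have szE : size t1 = size t2 by rewrite -!(size_map size) -/(shape t1) sh.
apply: (@eq_from_nth _ [::]) => // r rt.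
have szr : size (nth [::] t1 r) = size (nth [::] t2 r) by rewrite -!nth_shape sh.
by apply: (@eq_from_nth _ 0) => // c; rewrite -nth_shape => /e.
Qed.

Lemma rho_nil t : is_SSRCT [::] t ->
  let lam := shape (rho [::] t) in
  [/\ 0 \notin lam, forall r c, (c < nth 0 lam r) = (r < ngt t c 0)
    & forall r c x, (x < get (rho [::] t) r c) = (r < ngt t c x)].
Proof.
move=> t_ct /=; have [t_zct _] := SSRCT_zero_ct t_ct; case: t_ct => _ [_ [_ [inner0 [pos _]]]].
have anti c : count (fun x => c.+1 < x) [::] + ngt t c.+1 0
    <= count (fun x => c < x) [::] + ngt t c 0 by apply: ngt_anti.
have [lam0 lamP] := rho_shape inner0 pos (fun _ _ => erefl) anti.
split=> // r c x; have [cr|rc] := ltnP c (nth 0 (shape (rho [::] t)) r).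
  by rewrite (ltn_get_rho inner0 _ cr).
rewrite get_default; last by rewrite /in_shape -leqNgt.
by move: rc; rewrite leqNgt lamP; have := @ngt_leq t c 0 x isT; lia.
Qed.

Lemma count_shape t c : is_SSRT (rho [::] t) -> is_SSRCT [::] t ->
  count (fun x => c < x) (shape (rho [::] t)) = ngt t c 0.
Proof.
move=> [/andP[sorted_lam _] _] t_ct; have [_ lamP _] := rho_nil t_ct.
by apply: eq_ltn_all => r; rewrite -ltn_nth_sorted_geq // lamP.
Qed.

(** * Appending the row of exiting entries *)

Section AddRow.

Variables (t : tab) (H : seq nat).
Let e := nth 0 H.
Let m := rcons t (0 :: H).
Hypothesis t_ct : zero_ct t.
Hypothesis t_ne : [::] \notin t.
Hypothesis H_pos : forall c, c < size H -> 0 < e c.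
Hypothesis H_anti : forall c, e c.+1 <= e c.
Hypothesis H_trip : forall c r, c < size H -> e c <= get t r c -> e c < get t r c.+1.

Lemma get_add_row r c :
  get m r c = if r == size t then nth 0 (0 :: H) c else get t r c.
Proof.
rewrite /get /m nth_rcons; case: (ltngtP r (size t)) => // rt.
by rewrite [nth [::] t r]nth_default // ltnW.
Qed.

Lemma in_inner_add_row r c :
  in_inner (shape m) [:: 1] r c = (r == size t) && (c == 0).
Proof.
rewrite /in_inner size_map size_rcons subn1 /=.
have [rt|rt|->] := ltngtP r (size t); rewrite ?subnn ?ltnn //=; last by case: c.
have -> : r - size t = (r - size t).-1.+1 by lia.
by rewrite /= nth_nil.
Qed.

Lemma in_skew_add_row r c : in_skew (shape m) [:: 1] r c = (0 < get m r c).
Proof.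
rewrite /in_skew in_inner_add_row /in_shape nth_shape get_add_row nth_rcons.
have [sz _ _ _] := t_ct; case: (ltngtP r (size t)) => rt /=.
- by rewrite andbT sz.
- by rewrite /get [nth [::] t r]nth_default ?nth_nil // ltnW.
- case: c => [|c] /=; first by [].
  rewrite ltnS andbT; have [/H_pos->//|cH] := ltnP c (size H).
  by rewrite nth_default.
Qed.

(** The new row starts with the inner box, so [e c] sits in column [c.+1] and its triple condition
    is [H_trip]. *)
Lemma SSRCT_add_row : is_SSRCT [:: 1] m.
Proof.
have [sz row col0 trip] := t_ct.
have shE : shape m = rcons (shape t) (size H).+1 by rewrite /m /shape map_rcons.
have comp_t : is_composition (shape t).
  apply/allP => x /mapP[[|y s] st ->] //; by case/negP: t_ne.
split; first by rewrite shE /is_composition all_rcons.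
split=> //; split; first by rewrite shE; apply: leq_c_rcons.
split=> [r c|]; first by rewrite in_inner_add_row get_add_row => /andP[-> /eqP->].
split=> [r c|]; first by rewrite in_skew_add_row.
split=> [r c|]; [|split=> [r s rs|r s c rs]]; rewrite ?in_inner_add_row !in_skew_add_row.
- by rewrite !get_add_row; case: eqP => // _; case: c => [|c] //= _ _; apply: H_anti.
- by rewrite !get_add_row; case: eqP => //= _; case: eqP => //= _; apply: col0.
move=> s_gt0.
have st : s <= size t.
  rewrite leqNgt; apply/negP => ts; move: s_gt0.
  by rewrite get_add_row (gtn_eqF ts) => /get_gt0_size; rewrite ltnNge ltnW.
have r_lt : (r == size t) = false by rewrite ltn_eqF // (leq_trans rs st).
rewrite r_lt /= !get_add_row r_lt; move: s_gt0; rewrite get_add_row.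
case: eqP => [_|_] s_gt0 /andP[r_gt0 le].
  have cH : c < size H by rewrite ltnNge; apply/negP => cH; move: s_gt0; rewrite /= nth_default.
  by have := H_trip cH le; rewrite /e /=; lia.
by have := trip r s c rs s_gt0 le; lia.
Qed.

Lemma ngt_add_row c x : ngt m c x = ngt t c x + (x < nth 0 (0 :: H) c).
Proof. by rewrite /ngt /m -cats1 count_cat /= addn0. Qed.

Lemma rho_add_row :
  [/\ 0 \notin shape (rho [:: 1] m),
      forall r c, (c < nth 0 (shape (rho [:: 1] m)) r) = (r < (c == 0) + ngt m c 0),
      get (rho [:: 1] m) 0 0 = 0
    & forall r c x, c < nth 0 (shape (rho [:: 1] m)) r -> (r, c) != (0, 0) ->
      (x < get (rho [:: 1] m) r c) = (r < (c == 0) + ngt m c x)].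
Proof.
have hE c : count (fun x => c < x) [:: 1] = (c == 0) by case: c.
have [_ [_ [_ [inner0 [pos _]]]]] := SSRCT_add_row.
have cols c : foldr maxn 0 (shape m) <= c -> count (fun x => c < x) [:: 1] = 0.
  rewrite hE leqNgt ltn_foldr_maxn; case: c => // /hasPn /(_ (size H).+1).
  by rewrite /shape map_rcons mem_rcons mem_head => /(_ isT).
have anti c : count (fun x => c.+1 < x) [:: 1] + ngt m c.+1 0
    <= count (fun x => c < x) [:: 1] + ngt m c 0.
  rewrite !hE !ngt_add_row; have := ngt_anti c 0 t_ct; case: c => [|c] /=.
    by case: (0 < nth 0 H 0); lia.
  by have := H_anti c; rewrite /e; lia.
have [sh0 shP] := rho_shape inner0 pos cols anti.
split=> // [r c||r c x cr rc]; first by rewrite shP hE.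
  by apply: get_rho_inner.
rewrite (ltn_get_rho inner0 _ cr) ?hE //.
by move: rc; rewrite xpair_eqE; lia.
Qed.

End AddRow.

(** * Comparison of the two sides *)

Lemma sort_geq_rev (s : seq nat) :
  (forall c, nth 0 (rev s) c.+1 <= nth 0 (rev s) c) -> sort geq s = rev s.
Proof.
move=> anti; have geq_tr : transitive geq by move=> a b c /=; lia.
rewrite -[RHS](@sorted_sort _ geq) //; last by apply/(sortedP 0) => c _; apply: anti.
have geq_tot : total geq by move=> a b /=; lia.
have geq_asym : antisymmetric geq by move=> a b /=; lia.
by apply/(perm_sortP geq_tot geq_tr geq_asym); rewrite perm_sym perm_rev.
Qed.

(** Columns of an SSRT are strict, so the value [y.+1] occurs at most once in a column. *)
Lemma ngt_rho_strict t c y : is_SSRT (rho [::] t) -> is_SSRCT [::] t ->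
  ngt t c y <= (ngt t c y.+1).+1.
Proof.
move=> [_ [_ [_ strict]]] t_ct; have [_ lamP fK] := rho_nil t_ct.
rewrite leqNgt; apply/negP => lt2; set r := ngt t c y.+1 in lt2.
have := strict r c; rewrite /in_shape lamP; have := @ngt_leq t c 0 y isT.
have := fK r.+1 c y; have := fK r c y.+1; rewrite ltnn; lia.
Qed.

Theorem theorem5p3 (i : nat) (T : tab) :
  1 <= i -> is_SSRT T -> addable (shape T) i.-1 ->
  forall tau : tab, is_SSRCT [::] tau -> rho [::] tau = T ->
  exists m : tab, mu i tau = Some m /\ is_SSRCT [:: 1] m /\ rho [:: 1] m = jdt i T.
Proof.
case: i => // n _ T_ssrt; rewrite [n.+1.-1]/= => add tau tau_ct tauT; rewrite -tauT in T_ssrt add *.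
have [lam0 lamP fK] := rho_nil tau_ct; set lam := shape _ in lam0 lamP add.
have cntE c : count (fun x => c < x) lam = ngt tau c 0 by apply: count_shape.
have gap : (n == 0) || (ngt tau n 0 < ngt tau n.-1 0).
  by move: add; rewrite /addable !cntE; case: (n) => [|k] //=; rewrite cntE.
have [tau_z tau_ne] := SSRCT_zero_ct tau_ct.
have [t' [H [[muE szH] [t'_ct t'_ne] t'E eq_H lt_H]]] := zero_ct_mu_aux tau_z tau_ne gap.
set e := nth 0 (rev H) in t'E eq_H lt_H.
have e_ge c : n <= c -> e c = 0 by move=> nc; rewrite /e nth_default // size_rev szH.
(* If [e c < e c.+1], removing [e c.+1] would lower the count of column [c.+1] at [e c] below that
   of column [c] in [tau], against [eq_H]. *)
have e_anti c : e c.+1 <= e c.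
  have [cn|nc] := ltnP c n; last by rewrite e_ge // ltnW.
  have [_ eq_e] := eq_H c cn; rewrite leqNgt; apply/negP => lt_e.
  by have := t'E c.+1 (e c); have := ngt_anti c (e c) tau_z; rewrite lt_e eq_e; lia.
have sortH : sort geq H = rev H by apply: sort_geq_rev.
have e_pos c : c < size (rev H) -> 0 < e c by rewrite size_rev szH => /eq_H[].
have e_trip c r : c < size (rev H) -> e c <= get t' r c -> e c < get t' r c.+1.
  move=> cH; have e_gt0 := e_pos c cH; rewrite size_rev szH in cH.
  have [_ eq_e] := eq_H c cH => le_e; rewrite ltnNge; apply/negP => ge_e.
  have [_ row _ _] := t'_ct.
  (* The value [e c] occurs at most once in column [c] of [tau] and has been removed. Row [r] would
     make this inequality fail. *)
  have : ngt t' c (e c).-1 <= ngt t' c.+1 (e c).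
    have := ngt_rho_strict c (e c).-1 T_ssrt tau_ct; rewrite prednK //.
    by have := t'E c (e c).-1; have := t'E c (e c); lia.
  rewrite leqNgt => /negP; apply.
  rewrite !ngt_iota; apply: (sub_count_lt (x := r)).
  - by move=> s /=; have := row s c; lia.
  - by rewrite mem_iota /=; apply: (@get_gt0_size t' r c); lia.
  - by rewrite /= prednK.
  - by rewrite /= -leqNgt.
exists (rcons t' (0 :: rev H)); split; first by rewrite /mu muE sortH.
split; first exact: SSRCT_add_row.
have [sh0 shP get00 getP] := rho_add_row t'_ct t'_ne e_pos e_anti e_trip.
have ngtE c x := ngt_add_row t' (rev H) c x.
rewrite /jdt [n.+1.-1]/=; set i0 := count _ _.
have i0E : i0 = ngt tau n 0 by apply: cntE.
(* Each column left of [n] loses one box and gains one, the inner box in the case of column 0;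
   column [n] only gains. *)
have shE : shape (rho [:: 1] (rcons t' (0 :: rev H))) = incr_nth lam i0.
  have lam_i0 : nth 0 lam i0 = n.
    apply/eqP; rewrite eqn_leq leqNgt lamP i0E ltnn /=.
    by case: (n) gap => //= k gap'; rewrite lamP.
  apply: eq_shape => // [|r c].
    apply/(nthP 0) => -[r]; rewrite size_incr_nth nth_incr_nth => rs.
    have i0_le : i0 <= size lam by apply: count_size.
    case: eqP => // ri0; rewrite add0n => r0; have := ltn_nth_size r lam0.
    by rewrite r0; move: rs; case: ifP; lia.
  rewrite shP ngtE nth_incr_nth; have t'c := t'E c 0.
  have e_c : (0 < e c) = (c < n).
    by have [/eq_H[->]|/e_ge->] := ltnP c n.
  have e_c1 : (c == 0) + (0 < nth 0 (0 :: rev H) c) = (c <= n).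
    case: (c) => [|k] //=; rewrite -/(e k).
    by have [/eq_H[->]|/e_ge->] := ltnP k n.
  have lam_r := lamP r c; have lam_c : (c < n) = (i0 < ngt tau c 0) by rewrite -lamP lam_i0.
  have lam_n : (c != n) || (ngt tau c 0 == i0) by case: eqP => [->|] //=; rewrite i0E.
  case: (eqVneq i0 r) lam_r => [<-|r_i0] lam_r; first by rewrite lam_i0; lia.
  lia.
apply: eq_tab; first by rewrite shape_tab_of.
rewrite shE => r c cr; rewrite get_tab_of cr.
have [[-> ->] //|rc] := eqVneq (r, c) (0, 0).
rewrite -/(slide _ (_ :: _) _ _).
apply: eq_ltn_all => x; rewrite getP ?shE //.
have [cn|nc] := leqP c n; last first.
  rewrite slide_right // fK ngtE; case: c nc {cr rc} => // c nc.
  by rewrite /= -/(e c) e_ge // addn0 -t'E e_ge ?addn0 // ltnW.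
(* [t'] may be replaced by [tau] in column [k.+1]: their counts agree at every value from [e k.+1]
   on. *)
have ex : exits (ngt tau) n e.
  move=> k kn; have [_ eq_e] := eq_H k kn; split=> //.
    by rewrite -eq_e -t'E [_ < _]ltnNge e_anti addn0.
  by move=> y /andP[ge_y lt_y]; have := t'E k.+1 y; have := lt_H k y lt_y; lia.
rewrite (ltn_slide fK _ ex) //.
- rewrite ngtE; have := t'E c x; rewrite /e; case: (c) => [|k] /=; lia.
- by move=> k y; apply: ngt_anti.
(* The hole starts outside the shape, where [get] returns 0, which is also [e n]. *)
- rewrite e_ge //; apply/esym/eqP; rewrite -leqn0 leqNgt fK i0E ltnn //.
Qed.
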